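(* If an s-hypersequent $G:=\alpha_{1}\vdash\beta_{1}\mid\ldots\mid\alpha_{n}\vdash\beta_{n}$ is valid in $\mathcal{KC}_{RST}$ then $G$ is provable in \textbf{MPDBL5}.
   Context: Formulae of the language $\mathfrak{L}_{1}$ are built from object variables $p\in\textbf{OV}$, property variables $P\in\textbf{PV}$, constants $\top,\bot$, binary connectives $\sqcap,\sqcup$, unary negations $\neg,\lrcorner$ and unary modal connectives $\square,\blacksquare$; one defines $\lozenge\alpha:=\neg\square\neg\alpha$. \textbf{MPDBL} is the two-sorted hypersequent calculus for pure double Boolean algebras with operators; \textbf{MPDBL4} adds the axioms $\square\alpha\vdash\alpha$, $\alpha\vdash\blacksquare\alpha$, $\square\square\alpha\dashv\vdash\square\alpha$, $\blacksquare\blacksquare\alpha\dashv\vdash\blacksquare\alpha$; and \textbf{MPDBL5} is obtained from \textbf{MPDBL4} by adding the axioms $\lozenge\alpha\vdash\square\lozenge\alpha$ and $\blacksquare\lrcorner\blacksquare\lrcorner\alpha\vdash\lrcorner\blacksquare\lrcorner\alpha$. A Kripke context is $\mathbb{KC}=((G,R),(M,S),I)$ with $\mathbb{K}=(G,M,I)$ a context and $R\subseteq G\times G$, $S\subseteq M\times M$; $\mathcal{KC}_{RST}$ denotes the class of all Kripke contexts in which both $R$ and $S$ are reflexive, symmetric and transitive. A model is $(\mathbb{KC},v)$ with $v$ a valuation into the semiconcepts of $\mathbb{K}$ (object variables to left semiconcepts, property variables to right semiconcepts), where $\square$ and $\blacksquare$ are interpreted via lower approximations with respect to $R$ (on extents)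 and $S$ (on intents). A sequent $\alpha\vdash\beta$ is satisfied in a model iff $v(\alpha)\sqsubseteq v(\beta)$ in the algebra of semiconcepts; an s-hypersequent is satisfied in a model iff at least one component is; it is valid in a class of Kripke contexts iff it is satisfied in every model based on every Kripke context of the class. *)

(* Defs.v *)
From Stdlib Require List RelationClasses.
From mathcomp Require Import all_boot all_classical.

Set Implicit Arguments.
Unset Strict Implicit.
Unset Printing Implicit Defensive.

Local Open Scope classical_set_scope.

Inductive formula : Set :=
| OVar of nat
| PVar of nat
| Top
| Bot
| Meet of formula & formula
| Join of formula & formula
| Neg of formula
| Opp of formula
| Box of formula
| BBox of formula.

Inductive sequent : Set := Sequent of formula & formula.

Declare Scope pdbl_scope.
Delimit Scope pdbl_scope with PDBL.
Bind Scope pdbl_scope with formula sequent.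

Notation "⊤" := Top (at level 0) : pdbl_scope.
Notation "⊥" := Bot (at level 0) : pdbl_scope.
Notation "a ⊓ b" := (Meet a b) (at level 40, left associativity) : pdbl_scope.
Notation "a ⊔ b" := (Join a b) (at level 40, left associativity) : pdbl_scope.
Notation "¬ a" := (Neg a) (at level 35, right associativity) : pdbl_scope.
Notation "⌟ a" := (Opp a) (at level 35, right associativity) : pdbl_scope.
Notation "□ a" := (Box a) (at level 35, right associativity) : pdbl_scope.
Notation "■ a" := (BBox a) (at level 35, right associativity) : pdbl_scope.
Notation "◇ a" := (¬ □ ¬ a)%PDBL
  (at level 35, right associativity) : pdbl_scope.
Notation "a ∨ b" := (¬ (¬ a ⊓ ¬ b))%PDBL
  (at level 50, left associativity) : pdbl_scope.
Notation "a ∧ b" := (⌟ (⌟ a ⊔ ⌟ b))%PDBL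
  (at level 50, left associativity) : pdbl_scope.
Notation "a ⊢ b" := (Sequent a b) (at level 70, no associativity) : pdbl_scope.

Definition both_ways (a b : formula) : set sequent :=
  [set (a ⊢ b)%PDBL; (b ⊢ a)%PDBL].
Notation "a ⊣⊢ b" := (both_ways a b)
  (at level 70, no associativity) : pdbl_scope.

(* [α1 ⊢ β1 | ... | αn ⊢ βn] is the list of its components. The condition
   n >= 1 is not part of the type: the side contexts of the rules may be empty,
   and no derivable list is empty. *)
Definition hypersequent := seq sequent.

Local Open Scope pdbl_scope.

Inductive pdbl_axiom : set sequent :=
| ax_ovar p : pdbl_axiom (OVar p ⊢ OVar p ⊓ OVar p)
| ax_pvar P : pdbl_axiom (PVar P ⊔ PVar P ⊢ PVar P)
| ax_id a : pdbl_axiom (a ⊢ a)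
| ax_meetl a b : pdbl_axiom (a ⊓ b ⊢ a)
| ax_joinl a b : pdbl_axiom (a ⊢ a ⊔ b)
| ax_meetr a b : pdbl_axiom (a ⊓ b ⊢ b)
| ax_joinr a b : pdbl_axiom (b ⊢ a ⊔ b)
| ax_meet_idem a b : pdbl_axiom (a ⊓ b ⊢ (a ⊓ b) ⊓ (a ⊓ b))
| ax_join_idem a b : pdbl_axiom ((a ⊔ b) ⊔ (a ⊔ b) ⊢ a ⊔ b)
| ax_neg_idem a : pdbl_axiom (¬ (a ⊓ a) ⊢ ¬ a)
| ax_opp_idem a : pdbl_axiom (⌟ a ⊢ ⌟ (a ⊔ a))
| ax_neg_bot a : pdbl_axiom (a ⊓ ¬ a ⊢ ⊥)
| ax_opp_top a : pdbl_axiom (⊤ ⊢ a ⊔ ⌟ a)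
| ax_neg_neg a b s : (¬ ¬ (a ⊓ b) ⊣⊢ a ⊓ b) s -> pdbl_axiom s
| ax_opp_opp a b s : (⌟ ⌟ (a ⊔ b) ⊣⊢ a ⊔ b) s -> pdbl_axiom s
| ax_meet_join a b : pdbl_axiom (a ⊓ a ⊢ a ⊓ (a ⊔ b))
| ax_join_meet a b : pdbl_axiom (a ⊔ (a ⊓ b) ⊢ a ⊔ a)
| ax_meet_vee a b : pdbl_axiom (a ⊓ a ⊢ a ⊓ (a ∨ b))
| ax_join_wedge a b : pdbl_axiom (a ⊔ (a ∧ b) ⊢ a ⊔ a)
| ax_meet_distr a b c s :
    (a ⊓ (b ∨ c) ⊣⊢ (a ⊓ b) ∨ (a ⊓ c)) s -> pdbl_axiom s
| ax_join_distr a b c s :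
    (a ⊔ (b ∧ c) ⊣⊢ (a ⊔ b) ∧ (a ⊔ c)) s -> pdbl_axiom s
| ax_bot a : pdbl_axiom (⊥ ⊢ a)
| ax_top a : pdbl_axiom (a ⊢ ⊤)
| ax_negT : pdbl_axiom (¬ ⊤ ⊢ ⊥)
| ax_oppB : pdbl_axiom (⊤ ⊢ ⌟ ⊥)
| ax_negB s : (¬ ⊥ ⊣⊢ ⊤ ⊓ ⊤) s -> pdbl_axiom s
| ax_oppT s : (⌟ ⊤ ⊣⊢ ⊥ ⊔ ⊥) s -> pdbl_axiom s
| ax_compat a s :
    ((a ⊔ a) ⊓ (a ⊔ a) ⊣⊢ (a ⊓ a) ⊔ (a ⊓ a)) s -> pdbl_axiom s.

Inductive mpdbl_axiom : set sequent :=
| ax_pdbl s : pdbl_axiom s -> mpdbl_axiom s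
| ax_box_meet a b s : (□ a ⊓ □ b ⊣⊢ □ (a ⊓ b)) s -> mpdbl_axiom s
| ax_bbox_join a b s : (■ a ⊔ ■ b ⊣⊢ ■ (a ⊔ b)) s -> mpdbl_axiom s
| ax_box_negB s : (□ ¬ ⊥ ⊣⊢ ¬ ⊥) s -> mpdbl_axiom s
| ax_bbox_oppT s : (■ ⌟ ⊤ ⊣⊢ ⌟ ⊤) s -> mpdbl_axiom s
| ax_box_idem a s : (□ (a ⊓ a) ⊣⊢ □ a) s -> mpdbl_axiom s
| ax_bbox_idem a s : (■ (a ⊔ a) ⊣⊢ ■ a) s -> mpdbl_axiom s.

Inductive mpdbl4_axiom : set sequent :=
| ax_mpdbl s : mpdbl_axiom s -> mpdbl4_axiom s
| ax_box_T a : mpdbl4_axiom (□ a ⊢ a)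
| ax_bbox_T a : mpdbl4_axiom (a ⊢ ■ a)
| ax_box_4 a s : (□ □ a ⊣⊢ □ a) s -> mpdbl4_axiom s
| ax_bbox_4 a s : (■ ■ a ⊣⊢ ■ a) s -> mpdbl4_axiom s.

Inductive mpdbl5_axiom : set sequent :=
| ax_mpdbl4 s : mpdbl4_axiom s -> mpdbl5_axiom s
| ax_box_5 a : mpdbl5_axiom (◇ a ⊢ □ ◇ a)
| ax_bbox_5 a : mpdbl5_axiom (■ ⌟ ■ ⌟ a ⊢ ⌟ ■ ⌟ a).

(* The hypersequent calculus over a set [Ax] of sequents taken as axioms. *)
Inductive derivable (Ax : set sequent) : set hypersequent :=
| d_axiom s : Ax s -> derivable Ax [:: s]
(* purity: every element is ⊓-idempotent or ⊔-idempotent *)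
| d_pure a : derivable Ax [:: a ⊢ a ⊓ a; a ⊔ a ⊢ a]
| d_weak G s H : derivable Ax (G ++ H) -> derivable Ax (G ++ s :: H)
| d_contr G s H :
    derivable Ax (G ++ s :: s :: H) -> derivable Ax (G ++ s :: H)
| d_exch G s t H :
    derivable Ax (G ++ s :: t :: H) -> derivable Ax (G ++ t :: s :: H)
| d_meetl G a b c H : derivable Ax (G ++ (a ⊢ b) :: H) ->
    derivable Ax (G ++ (a ⊓ c ⊢ b ⊓ c) :: H)
| d_meetr G a b c H : derivable Ax (G ++ (a ⊢ b) :: H) ->
    derivable Ax (G ++ (c ⊓ a ⊢ c ⊓ b) :: H)
| d_joinl G a b c H : derivable Ax (G ++ (a ⊢ b) :: H) ->
    derivable Ax (G ++ (a ⊔ c ⊢ b ⊔ c) :: H)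
| d_joinr G a b c H : derivable Ax (G ++ (a ⊢ b) :: H) ->
    derivable Ax (G ++ (c ⊔ a ⊢ c ⊔ b) :: H)
| d_neg G a b H : derivable Ax (G ++ (a ⊢ b) :: H) ->
    derivable Ax (G ++ (¬ b ⊢ ¬ a) :: H)
| d_opp G a b H : derivable Ax (G ++ (a ⊢ b) :: H) ->
    derivable Ax (G ++ (⌟ b ⊢ ⌟ a) :: H)
| d_box G a b H : derivable Ax (G ++ (a ⊢ b) :: H) ->
    derivable Ax (G ++ (□ a ⊢ □ b) :: H)
| d_bbox G a b H : derivable Ax (G ++ (a ⊢ b) :: H) ->
    derivable Ax (G ++ (■ a ⊢ ■ b) :: H)
| d_trans G a b c H :
    derivable Ax (G ++ (a ⊢ b) :: H) -> derivable Ax (G ++ (b ⊢ c) :: H) ->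
    derivable Ax (G ++ (a ⊢ c) :: H)
(* a ⊑ b as soon as a ⊓ b = a ⊓ a and a ⊔ b = b ⊔ b *)
| d_order G a b H :
    derivable Ax (G ++ (a ⊓ b ⊢ a ⊓ a) :: H) ->
    derivable Ax (G ++ (a ⊓ a ⊢ a ⊓ b) :: H) ->
    derivable Ax (G ++ (a ⊔ b ⊢ b ⊔ b) :: H) ->
    derivable Ax (G ++ (b ⊔ b ⊢ a ⊔ b) :: H) ->
    derivable Ax (G ++ (a ⊢ b) :: H).

Definition MPDBL : set hypersequent := derivable mpdbl_axiom.
Definition MPDBL4 : set hypersequent := derivable mpdbl4_axiom.
Definition MPDBL5 : set hypersequent := derivable mpdbl5_axiom.

Local Close Scope pdbl_scope.

Record context := Context {
  obj : Type;
  attr : Type;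
  incid : obj -> attr -> Prop }.

Section Semiconcepts.
Variable K : context.
Implicit Types (A : set (obj K)) (B : set (attr K)).

Definition up A : set (attr K) := [set m | forall g, A g -> incid g m].
Definition down B : set (obj K) := [set g | forall m, B m -> incid g m].

Record semiconcept := Semiconcept {
  ext : set (obj K);
  int : set (attr K);
  semiconceptP : up ext = int \/ down int = ext }.
Implicit Types x y : semiconcept.

Definition is_left x := up (ext x) = int x.
Definition is_right x := down (int x) = ext x.

Definition lsemi A : semiconcept := @Semiconcept A (up A) (or_introl erefl).
Definition rsemi B : semiconcept := @Semiconcept (down B) B (or_intror erefl).

Lemma up0 : up set0 = setT. Proof. by apply/seteqP; split=> // m _ g. Qed.
Lemma down0 : down set0 = setT. Proof. by apply/seteqP; split=> // g _ m. Qed.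

Definition stop : semiconcept := @Semiconcept setT set0 (or_intror down0).
Definition sbot : semiconcept := @Semiconcept set0 setT (or_introl up0).
Definition smeet x y : semiconcept := lsemi (ext x `&` ext y).
Definition sjoin x y : semiconcept := rsemi (int x `&` int y).
Definition sneg x : semiconcept := lsemi (~` ext x).
Definition sopp x : semiconcept := rsemi (~` int x).

(* The quasi-order of a double Boolean algebra. *)
Definition sle x y : Prop := smeet x y = smeet x x /\ sjoin x y = sjoin y y.

Lemma sleP x y : sle x y <-> ext x `<=` ext y /\ int y `<=` int x.
Proof.
rewrite /sle /smeet /sjoin !setIid; split=> [[exy ixy]|[/setIidl-> /setIidr->]] //.
split; first by rewrite -(congr1 ext exy) /=; exact: subIsetr.
by rewrite -(congr1 int ixy) /=; exact: subIsetl.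
Qed.

End Semiconcepts.

Record kripke_context := KripkeContext {
  base :> context;
  orel : obj base -> obj base -> Prop;
  arel : attr base -> attr base -> Prop }.

Definition lower (T : Type) (R : T -> T -> Prop) (A : set T) : set T :=
  [set x | [set y | R x y] `<=` A].

Section Semantics.
Variable KC : kripke_context.

Definition sbox (x : semiconcept KC) : semiconcept KC :=
  lsemi (lower (@orel KC) (ext x)).
Definition sbbox (x : semiconcept KC) : semiconcept KC :=
  rsemi (lower (@arel KC) (int x)).

Record valuation := Valuation {
  vobj : nat -> semiconcept KC;
  vprop : nat -> semiconcept KC;
  vobjP : forall p, is_left (vobj p);
  vpropP : forall P, is_right (vprop P) }.

Variable v : valuation.

Fixpoint eval (a : formula) : semiconcept KC :=
  match a with
  | OVar p => vobj v p
  | PVar P => vprop v P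
  | Top => stop KC
  | Bot => sbot KC
  | Meet b c => smeet (eval b) (eval c)
  | Join b c => sjoin (eval b) (eval c)
  | Neg b => sneg (eval b)
  | Opp b => sopp (eval b)
  | Box b => sbox (eval b)
  | BBox b => sbbox (eval b)
  end.

Definition satisfies_sequent (s : sequent) : Prop :=
  let: Sequent a b := s in sle (eval a) (eval b).

Definition satisfies (G : hypersequent) : Prop :=
  List.Exists satisfies_sequent G.

End Semantics.

Definition valid_in (C : set kripke_context) (G : hypersequent) : Prop :=
  forall KC, C KC -> forall v : valuation KC, satisfies v G.

Definition equivalence_relation (T : Type) (R : T -> T -> Prop) : Prop :=
  [/\ RelationClasses.Reflexive R, RelationClasses.Symmetric R
    & RelationClasses.Transitive R].

Definition KC_RST : set kripke_context :=
  [set KC | equivalence_relation (@orel KC) /\ equivalence_relation (@arel KC)].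

(* Main.v *)
Require Import Defs.
From mathcomp Require Import all_boot all_classical.
From Stdlib Require List.

(** By contraposition. If [G] is underivable, Zorn's lemma gives a maximal set
    [D] of sequents that contains [G] and has no derivable finite list of
    elements. The sequents [s] such that [s | L] is derivable for some [L] in [D]
    form a theory closed under the axioms and rules; by maximality one of the
    two components of every purity axiom belongs to it, so that its formulas
    form a pure double Boolean algebra with operators.
    Its canonical context has as objects the ultrafilters of the Boolean algebra
    of ⊓-idempotents, as attributes those of the order dual of the algebra of
    ⊔-idempotents, and [F] is incident to [J] when they meet. Purity makes
    [a |-> (ultrafilters through a, dual ultrafilters through a)] a semiconcept,
    and two worlds are related when they contain the same boxed formulas. *)

Set Implicit Arguments.
Unset Strict Implicit.
Unset Printing Implicit Defensive.

Local Open Scope classical_set_scope.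

(** [Zorn_bigcup] also asks about the empty chain, whose union is empty. Passing to the sets whose
    union with [A0] satisfies [P] reduces that case to [P A0]. *)
Lemma Zorn_above (T : Type) (P : set (set T)) (A0 : set T) :
  P A0 ->
  (forall F : set (set T), F `<=` P -> F !=set0 -> total_on F subset ->
    P (\bigcup_(X in F) X)) ->
  exists A, [/\ A0 `<=` A, P A & forall B, A `<=` B -> P B -> B `<=` A].
Proof.
move=> PA0 Pchain.
have [F FP Ftot|A [PA Amax]] := @Zorn_bigcup T [set A | P (A0 `|` A)].
  rewrite /=; have [->|/set0P[X FX]] := eqVneq F set0; first by rewrite bigcup_set0 setU0.
  have -> : A0 `|` \bigcup_(X in F) X =
            \bigcup_(Y in [set A0 `|` X | X in F]) Y.
    apply/seteqP; split=> [x [A0x|[Y FY Yx]]|x [_ [Y FY <-]] [A0x|Yx]].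
    - by exists (A0 `|` X); [exists X|left].
    - by exists (A0 `|` Y); [exists Y|right].
    - by left.
    - by right; exists Y.
  apply: Pchain => [_ [Y FY <-]||_ _ [Y FY <-] [Z FZ <-]].
  - exact: FP.
  - by exists (A0 `|` X), X.
  - by have [YZ|ZY] := Ftot _ _ FY FZ; [left|right]; exact: setUS.
exists (A0 `|` A); split=> // B AB PB x Bx.
apply: contrapT => nx; apply: (Amax B) => /=.
  split; first by move=> y Ay; apply: AB; right.
  by move=> /(_ x Bx) Ax; apply: nx; right.
by rewrite setUidr // => y A0y; apply: AB; left.
Qed.

(** * Boolean reasoning in one half of the algebra *)

(* The ⊓-idempotent half of a double Boolean algebra with operators; the
   ⊔-idempotent half is the same structure for the reversed order. *)
Record modal_half (X : Type) (le : X -> X -> Prop) (meet : X -> X -> X)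
    (neg box : X -> X) (top bot : X) : Prop := ModalHalf {
  mh_refl : forall a, le a a;
  mh_trans : forall a b c, le a b -> le b c -> le a c;
  mh_meetl : forall a b, le (meet a b) a;
  mh_meetr : forall a b, le (meet a b) b;
  mh_meet_mono : forall a b c d, le a b -> le c d -> le (meet a c) (meet b d);
  mh_meet_idem : forall a b, le (meet a b) (meet (meet a b) (meet a b));
  mh_neg_anti : forall a b, le a b -> le (neg b) (neg a);
  mh_neg_idem : forall a, le (neg (meet a a)) (neg a);
  mh_neg_bot : forall a, le (meet a (neg a)) bot;
  mh_neg_neg_le : forall a b, le (neg (neg (meet a b))) (meet a b);
  mh_neg_neg_ge : forall a b, le (meet a b) (neg (neg (meet a b)));
  mh_distr : forall a b c,
    le (meet a (neg (meet (neg b) (neg c))))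
       (neg (meet (neg (meet a b)) (neg (meet a c))));
  mh_bot : forall a, le bot a;
  mh_top : forall a, le a top;
  mh_negB : le (meet top top) (neg bot);
  mh_box_mono : forall a b, le a b -> le (box a) (box b);
  mh_box_meet_le : forall a b, le (meet (box a) (box b)) (box (meet a b));
  mh_box_meet_ge : forall a b, le (box (meet a b)) (meet (box a) (box b));
  mh_box_negB : le (neg bot) (box (neg bot));
  mh_box_idem : forall a, le (box a) (box (meet a a));
  mh_box_T : forall a, le (box a) a;
  mh_box_4 : forall a, le (box a) (box (box a));
  mh_box_5 : forall a, le (neg (box (neg a))) (box (neg (box (neg a)))) }.

Section ModalHalf.
Variables (X : Type) (le : X -> X -> Prop) (meet : X -> X -> X).
Variables (neg box : X -> X) (top bot : X).
Hypothesis H : modal_half le meet neg box top bot.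

Let le_refl := mh_refl H.
Let le_trans := mh_trans H.
Let meet_mono := mh_meet_mono H.

(** Since [meet x x] can lie strictly below [x], two upper bounds of [x] combine into their meet
    only for ⊓-idempotent [x]. *)
Lemma mh_glb x a b : le x (meet x x) -> le x a -> le x b -> le x (meet a b).
Proof. by move=> xx xa xb; apply: (le_trans xx (meet_mono xa xb)). Qed.

Lemma mh_negK_le a : le (neg (neg a)) (meet a a).
Proof.
exact: (le_trans (mh_neg_anti H (mh_neg_idem H a)) (mh_neg_neg_le H a a)).
Qed.

Lemma mh_negK_ge a : le (meet a a) (neg (neg a)).
Proof.
apply: (le_trans (mh_neg_neg_ge H a a) _).
exact/(mh_neg_anti H)/(mh_neg_anti H)/(mh_meetl H).
Qed.

(** Triple negation: [neg a] lies below [neg (neg (neg a))], which lies below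
    [meet (neg a) (neg a)]. *)
Lemma mh_neg_left a : le (neg a) (meet (neg a) (neg a)).
Proof.
apply: (le_trans _ (mh_negK_le (neg a))).
apply: (le_trans _ (mh_neg_anti H (mh_negK_le a))).
exact/(mh_neg_anti H)/(mh_meetl H).
Qed.

Lemma mh_box_left a : le (box a) (meet (box a) (box a)).
Proof. exact: (le_trans (mh_box_idem H a) (mh_box_meet_ge H a a)). Qed.

Lemma mh_join_lub a b r : le a r -> le b r ->
  le (neg (meet (neg a) (neg b))) r.
Proof.
move=> ar br; apply: (le_trans _ (mh_meetl H r r)).
apply: (le_trans _ (mh_negK_le r)); apply: (mh_neg_anti H).
by apply: mh_glb; [exact: mh_neg_left|exact: (mh_neg_anti H ar)|
  exact: (mh_neg_anti H br)].
Qed.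

(** Excluded middle puts [meet f f] below the meet of [f] with the derived join of [a] and [neg a];
    distributivity splits this into the two cases. *)
Lemma mh_cases f a r : le (meet f a) r -> le (meet f (neg a)) r ->
  le (meet f f) r.
Proof.
move=> far fnar.
apply: (le_trans _ (mh_join_lub far fnar)).
apply: (le_trans _ (mh_distr H f a (neg a))).
apply: mh_glb; [exact: (mh_meet_idem H)|exact: (mh_meetl H)|].
apply: (le_trans (meet_mono (mh_top H f) (mh_top H f)) _).
apply: (le_trans (mh_negB H) _).
exact/(mh_neg_anti H)/(mh_neg_bot H).
Qed.

(** * Ultrafilters, separation and the modal operator *)

Record filter_base (F : set X) : Prop := FilterBase {
  fb_nonempty : F !=set0;
  fb_up : forall a b, F a -> le a b -> F b;
  fb_meet : forall a b, F a -> F b -> F (meet a b) }.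

Record ultrafilter (F : set X) : Prop := Ultrafilter {
  uf_up : forall a b, F a -> le a b -> F b;
  uf_meet : forall a b, F a -> F b -> F (meet a b);
  uf_neg : forall a, F (neg a) <-> ~ F a }.

(* An ideal in the sense of the order only: it need not be closed under any
   operation, so that a principal downset and a dual ultrafilter both qualify. *)
Record order_ideal (J : set X) : Prop := OrderIdeal {
  oi_nonempty : J !=set0;
  oi_down : forall a b, J b -> le a b -> J a;
  oi_directed : forall a b, J a -> J b -> exists r, [/\ J r, le a r & le b r] }.

Lemma order_ideal_principal a : order_ideal [set x | le x a].
Proof.
split=> [|x y /= ya xy|x y /= xa ya]; first by exists a; exact: le_refl.
- exact: (le_trans xy ya).
- by exists a; split=> //; exact: le_refl.
Qed.

Lemma filter_base_principal a : le a (meet a a) -> filter_base [set x | le a x].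
Proof.
move=> aa; split=> [|x y /= ax xy|x y /= ax ay]; first by exists a; exact: le_refl.
- exact: (le_trans ax xy).
- exact: mh_glb.
Qed.

(** Prime filter theorem. If a filter maximal among those avoiding [J] contained neither [a] nor
    [neg a], adjoining either would reach [J]; [mh_cases] under a common bound in [J] then puts one
    of its own elements in [J]. *)
Lemma ultrafilter_separation (F J : set X) :
  filter_base F -> order_ideal J -> F `&` J = set0 ->
  exists U, [/\ ultrafilter U, F `<=` U & U `&` J = set0].
Proof.
move=> Ff Ji FJ.
pose P (A : set X) := filter_base A /\ A `&` J = set0.
have [|C CP [A0 CA0] Ctot|U [FU [Uf UJ] Umax]] := @Zorn_above X P F.
- by [].
- split; first split.
  + by have [x A0x] := fb_nonempty (CP _ CA0).1; exists x, A0.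
  + by move=> a b [A CA Aa] ab; exists A => //; apply: (fb_up (CP _ CA).1 Aa ab).
  + move=> a b [A CA Aa] [B CB Bb].
    have [AB|BA] := Ctot _ _ CA CB.
    * by exists B => //; apply: (fb_meet (CP _ CB).1 (AB _ Aa) Bb).
    * by exists A => //; apply: (fb_meet (CP _ CA).1 Aa (BA _ Bb)).
  + by rewrite setI_bigcupl bigcup0 // => A /CP[].
have disj x : U x -> J x -> False by move=> Ux Jx; rewrite -[False]/(set0 x) -UJ.
have extend a : ~ U a -> exists2 f, U f & J (meet f a).
  move=> nUa; apply: contrapT => noJ; apply: nUa.
  have [u Uu] := fb_nonempty Uf.
  (* The filter generated by [U] and [a] avoids [J] under [noJ], so maximality puts [a] in [U]. *)
  apply: (Umax [set y | exists2 f, U f & le (meet f a) y]) => [x Ux||].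
  - by exists x => //; exact: (mh_meetl H).
  - split; last first.
      rewrite -subset0 => y [[f Uf0 fay] Jy]; apply: noJ; exists f => //.
      exact: (oi_down Ji) Jy fay.
    split; first by exists a, u => //; exact: (mh_meetr H).
    + by move=> x y [f Uf0 fx] xy; exists f => //; exact: (le_trans fx xy).
    + move=> x y [f Uf0 fx] [g Ug gy]; exists (meet f g); first exact: fb_meet.
      apply: mh_glb; first exact: (mh_meet_idem H).
      * by apply: (le_trans _ fx); apply: meet_mono; [exact: (mh_meetl H)|exact: le_refl].
      * by apply: (le_trans _ gy); apply: meet_mono; [exact: (mh_meetr H)|exact: le_refl].
  - by exists u => //; exact: (mh_meetr H).
exists U; split=> //; split; [exact: fb_up|exact: fb_meet|move=> a; split].
- move=> Una Ua; have [j Jj] := oi_nonempty Ji.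
  apply: (disj bot); last exact: (oi_down Ji) Jj (mh_bot H j).
  exact: (fb_up Uf (fb_meet Uf Ua Una) (mh_neg_bot H a)).
- move=> /extend[f Uf1 Jf]; apply: contrapT => /extend[g Ug Jg].
  have Ufg := fb_meet Uf Uf1 Ug.
  have Jfg : J (meet (meet f g) a).
    by apply: (oi_down Ji) Jf _; apply: meet_mono; [exact: (mh_meetl H)|exact: le_refl].
  have Jgf : J (meet (meet f g) (neg a)).
    by apply: (oi_down Ji) Jg _; apply: meet_mono; [exact: (mh_meetr H)|exact: le_refl].
  have [r [Jr ar br]] := oi_directed Ji Jfg Jgf.
  apply: (disj _ (fb_meet Uf Ufg Ufg)).
  exact: (oi_down Ji) Jr (mh_cases ar br).
Qed.

Section Ultrafilter.
Variables (F : set X) (UF : ultrafilter F).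

Lemma uf_nonempty : F !=set0.
Proof.
have [Fb|nFb] := EM (F bot); first by exists bot.
by exists (neg bot); exact/(uf_neg UF).
Qed.

Lemma uf_top : F top.
Proof. by have [a Fa] := uf_nonempty; apply: (uf_up UF Fa (mh_top H a)). Qed.

Lemma uf_bot : ~ F bot.
Proof.
by move=> Fb; apply/(uf_neg UF): (Fb); apply: (uf_up UF Fb (mh_bot H _)).
Qed.

Lemma uf_meetE a b : F (meet a b) <-> F a /\ F b.
Proof.
split=> [Fab|[]]; last exact: uf_meet.
by split; apply: (uf_up UF Fab _); [exact: (mh_meetl H)|exact: (mh_meetr H)].
Qed.

Lemma uf_boxes_filter_base : filter_base [set c | F (box c)].
Proof.
split=> [|a b /= Fa ab|a b /= Fa Fb].
- exists (neg bot) => /=; apply: (uf_up UF _ (mh_box_negB H)).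
  exact/(uf_neg UF)/uf_bot.
- exact: (uf_up UF Fa (mh_box_mono H ab)).
- exact: (uf_up UF (uf_meet UF Fa Fb) (mh_box_meet_le H a b)).
Qed.

(** Axiom 5 only speaks of [box (neg _)]; it is used at [neg b], since [box] does not distinguish
    [b] from its double negation. *)
Lemma uf_neg_box b : ~ F (box b) -> F (box (neg (box b))).
Proof.
move=> /(uf_neg UF) Fnb.
have bb : le (box b) (box (neg (neg b))).
  exact: (le_trans (mh_box_idem H b) (mh_box_mono H (mh_negK_ge b))).
have bb' : le (box (neg (neg b))) (box b).
  by apply: (mh_box_mono H); exact: (le_trans (mh_negK_le b) (mh_meetl H b b)).
have Fn : F (neg (box (neg (neg b)))) by apply: (uf_up UF Fnb (mh_neg_anti H bb')).
apply: (uf_up UF (uf_up UF Fn (mh_box_5 H _)) _).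
exact: (mh_box_mono H (mh_neg_anti H bb)).
Qed.

(** If [box a] is not in [F], some ultrafilter contains every [c] with [box c] in [F] but omits [a].
    It has the same boxes as [F]: axiom 4 carries them over, and axiom 5 excludes new ones. *)
Lemma uf_boxP a : F (box a) <->
  forall U, ultrafilter U -> (forall b, F (box b) <-> U (box b)) -> U a.
Proof.
split=> [Fa U UU FU|FUa].
  by apply: (uf_up UU _ (mh_box_T H a)); exact/FU.
apply: contrapT => nFa.
have [|U [UU BU UJ]] := ultrafilter_separation uf_boxes_filter_base
    (order_ideal_principal a).
  rewrite -subset0 => c [/= Fc ca]; apply: nFa.
  exact: (uf_up UF Fc (mh_box_mono H ca)).
rewrite -[False]/(set0 a) -UJ; split; last exact: le_refl.
apply: FUa => // b; split=> [Fb|Ub].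
  by apply: BU; apply: (uf_up UF Fb (mh_box_4 H b)).
by apply: contrapT => /uf_neg_box/BU /(uf_neg UU).
Qed.

End Ultrafilter.

Lemma ultrafilter_avoiding_ideal a J : le a (meet a a) -> order_ideal J -> ~ J a ->
  exists U, [/\ ultrafilter U, U a & U `&` J = set0].
Proof.
move=> aa Ji nJa.
have [|U [UU aU UJ]] := ultrafilter_separation (filter_base_principal aa) Ji.
  by rewrite -subset0 => c [/= ac Jc]; apply: nJa; apply: (oi_down Ji) Jc ac.
by exists U; split=> //; apply: aU; exact: le_refl.
Qed.

(** Ultrafilters do not distinguish [a] from [meet a a], so only an inequality between ⊓-idempotents
    can be recovered. *)
Lemma ultrafilter_le a b :
  (forall U, ultrafilter U -> U a -> U b) -> le (meet a a) (meet a b).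
Proof.
move=> ab; apply: contrapT => nab.
have [U [UU Ua UJ]] := ultrafilter_avoiding_ideal (mh_meet_idem H a a)
  (order_ideal_principal (meet a b)) nab.
have {}Ua : U a by apply: (uf_up UU Ua (mh_meetl H a a)).
rewrite -[False]/(set0 (meet a b)) -UJ; split; last exact: le_refl.
by apply: (uf_meet UU Ua); exact: ab.
Qed.

End ModalHalf.

(** Lets a dual ultrafilter serve as the ideal to be avoided; it is directed because joins are upper
    bounds. *)
Lemma ultrafilter_dual_ideal (X : Type) (le : X -> X -> Prop)
    (join : X -> X -> X) (opp box : X -> X) (top bot : X) (J : set X) :
  modal_half (fun a b => le b a) join opp box bot top ->
  ultrafilter (fun a b => le b a) join opp J -> order_ideal le J.
Proof.
move=> H UJ; split; first exact: (uf_nonempty top UJ).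
- by move=> a b Jb ab; apply: (uf_up UJ Jb ab).
- move=> a b Ja Jb; exists (join a b).
  by split; [exact: (uf_meet UJ Ja Jb)|exact: (mh_meetl H a b)|exact: (mh_meetr H a b)].
Qed.

(** * Structural rules and the Lindenbaum construction *)

Section Calculus.
Variable Ax : set sequent.

Lemma d_move s A B : derivable Ax (s :: A ++ B) -> derivable Ax (A ++ s :: B).
Proof.
rewrite -[s :: _]/([::] ++ s :: A ++ B) -[A ++ s :: B]/([::] ++ A ++ s :: B).
elim: A [::] => [|t A IH] C //= h.
by rewrite -cat_rcons; apply: IH; rewrite cat_rcons; apply: d_exch.
Qed.

Lemma d_absorb s G : List.In s G -> derivable Ax (s :: G) -> derivable Ax G.
Proof.
move=> /(@List.in_split _ _ _)[G1 [G2 ->]] d.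
exact: (d_contr (d_move (A := G1) (B := s :: G2) d)).
Qed.

(** Weakening appends all of [G]; each component of [L] is then contracted into its copy there. *)
Lemma d_incl L G : List.incl L G -> derivable Ax L -> derivable Ax G.
Proof.
move=> LG dL.
have {dL} : derivable Ax (L ++ G).
  elim: G {LG} => [|s G IH]; [by rewrite cats0|exact: d_weak].
elim: L LG => [|s L IH] //= sLG d; apply: IH => [t Lt|]; first by apply: sLG; right.
by apply: (d_absorb _ d); apply/List.in_or_app; right; apply: sLG; left.
Qed.

(** [D] is read as a set of refuted sequents: [s] holds when all its alternatives in a derivable
    hypersequent are refuted. *)
Definition derivable_modulo (D : set sequent) : set sequent :=
  [set s | exists2 L, (forall t, List.In t L -> D t) & derivable Ax (s :: L)].

Definition consistent (D : set sequent) : Prop :=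
  forall L, (forall t, List.In t L -> D t) -> ~ derivable Ax L.

(** The lists witnessing the premises are concatenated into one side context, which the rule then
    shares. *)
Lemma derivable_modulo_rule D (S : seq sequent) t :
  (forall H, (forall s, List.In s S -> derivable Ax (s :: H)) ->
    derivable Ax (t :: H)) ->
  (forall s, List.In s S -> derivable_modulo D s) -> derivable_modulo D t.
Proof.
move=> rule DS.
have [L LD dL] : exists2 L, (forall t, List.In t L -> D t) &
    forall s, List.In s S -> derivable Ax (s :: L).
  elim: S DS {rule} => [|s S IH] DS; first by exists [::].
  have [L LD dL] := IH (fun u Su => DS u (or_intror Su)).
  have [L' LD' dL'] := DS s (or_introl erefl).
  exists (L ++ L') => [u /(@List.in_app_or _ _ _ _)[/LD|/LD']//|u [<-|Su]].
    apply: (d_incl _ dL') => w [->|L'w]; first by left.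
    by right; apply/List.in_or_app; right.
  apply: (d_incl _ (dL u Su)) => w [->|Lw]; first by left.
  by right; apply/List.in_or_app; left.
by exists L => //; exact: rule.
Qed.

Lemma derivable_modulo_axiom D s : Ax s -> derivable_modulo D s.
Proof. by move=> As; exists [::] => //; exact: d_axiom. Qed.

(** For a maximal consistent [D] above [G], consistency keeps members of [D] from being derivable
    modulo [D], while maximality makes all other sequents so. A derivable pair cannot lie inside
    [D]. *)
Lemma lindenbaum G : ~ derivable Ax G -> exists D : set sequent,
  [/\ forall s, List.In s G -> ~ derivable_modulo D s &
      forall s t, derivable Ax [:: s; t] -> derivable_modulo D s \/ derivable_modulo D t].
Proof.
move=> ndG.
have [|C CP [A0 CA0] Ctot|D [GD Dc Dmax]] :=
    @Zorn_above sequent consistent [set s | List.In s G].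
- by move=> L LG dL; apply: ndG; exact: (d_incl LG dL).
- move=> L LC; have [A CA LA] : exists2 A, C A & forall t, List.In t L -> A t.
    elim: L LC => [|s L IH] LC; first by exists A0.
    have [A CA LA] := IH (fun u Lu => LC u (or_intror Lu)).
    have [B CB Bs] := LC s (or_introl erefl).
    have [AB|BA] := Ctot _ _ CA CB.
      by exists B => // u [<-//|/LA]; exact: AB.
    by exists A => // u [<-|/LA//]; exact: BA.
  exact: (CP _ CA _ LA).
have outside s : ~ D s -> derivable_modulo D s.
  move=> nDs; apply: contrapT => nr; apply: nDs.
  apply: (Dmax (s |` D)) => [t Dt||]; [by right| |by left].
  move=> L LsD dL; apply: nr.
  (* [L'] collects the components of [L] from [D]; all copies of [s] merge into the head. *)
  have [L' L'D LL'] : exists2 L', (forall t, List.In t L' -> D t) &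
      List.incl L (s :: L').
    elim: L LsD {dL} => [|u L IH] LsD; first by exists [::].
    have [L' L'D LL'] := IH (fun w Lw => LsD w (or_intror Lw)).
    have [->|Du] := LsD u (or_introl erefl).
      by exists L' => // w [<-|/LL'//]; left.
    exists (u :: L') => [w [<-//|/L'D]//|w [<-|/LL'[<-|L'w]]]; first by right; left.
      by left.
    by right; right.
  by exists L' => //; exact: (d_incl LL' dL).
exists D; split=> [s /GD Ds [L LD dL]|s t dst].
  by apply: (Dc _ _ dL) => u [<-//|/LD].
have [Ds|/outside] := EM (D s); last by left.
have [Dt|/outside] := EM (D t); last by right.
by case: (Dc _ _ dst) => u [<-//|[<-//|[]]].
Qed.

End Calculus.

(** * The theory as a double Boolean algebra with operators *)

Section Theory.
Variable D : set sequent.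

Let le a b := derivable_modulo mpdbl5_axiom D (Sequent a b).
Let ge a b := le b a.

Let ax_le a b : mpdbl5_axiom (Sequent a b) -> le a b.
Proof. exact: derivable_modulo_axiom. Qed.

Let m_le a b : mpdbl_axiom (Sequent a b) -> le a b.
Proof. by move=> h; apply: ax_le; do 2 constructor. Qed.

Let p_le a b : pdbl_axiom (Sequent a b) -> le a b.
Proof. by move=> h; apply: m_le; constructor. Qed.

Let rule1 a b c d :
  (forall H, derivable mpdbl5_axiom (Sequent a b :: H) ->
     derivable mpdbl5_axiom (Sequent c d :: H)) -> le a b -> le c d.
Proof.
move=> rule ab; apply: (@derivable_modulo_rule _ _ [:: Sequent a b]).
  by move=> H /(_ _ (or_introl erefl)); exact: rule.
by move=> s [<-|[]].
Qed.

Let le_trans a b c : le a b -> le b c -> le a c.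
Proof.
move=> ab bc.
apply: (@derivable_modulo_rule _ _ [:: Sequent a b; Sequent b c]) => [H dH|s].
  by apply: (d_trans (G := [::]) (b := b)); apply: dH; [left|right; left].
by move=> [<-|[<-|[]]].
Qed.

Lemma theory_order a b :
  le (Meet a b) (Meet a a) -> le (Meet a a) (Meet a b) ->
  le (Join a b) (Join b b) -> le (Join b b) (Join a b) -> le a b.
Proof.
move=> h1 h2 h3 h4.
apply: (@derivable_modulo_rule _ _ [:: Sequent (Meet a b) (Meet a a);
  Sequent (Meet a a) (Meet a b); Sequent (Join a b) (Join b b);
  Sequent (Join b b) (Join a b)]) => [H dH|s].
  apply: (d_order (G := [::])); apply: dH => /=; tauto.
by move=> [<-|[<-|[<-|[<-|[]]]]].
Qed.

Lemma theory_left : modal_half le Meet Neg Box Top Bot.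
Proof.
split=> *.
- exact/p_le/ax_id.
- by apply: le_trans; eassumption.
- exact/p_le/ax_meetl.
- exact/p_le/ax_meetr.
- by apply: le_trans; [apply: (rule1 (@d_meetl _ [::] _ _ _))|
    apply: (rule1 (@d_meetr _ [::] _ _ _))]; eassumption.
- exact/p_le/ax_meet_idem.
- by apply: (rule1 (@d_neg _ [::] _ _)); eassumption.
- exact/p_le/ax_neg_idem.
- exact/p_le/ax_neg_bot.
- by apply/p_le/ax_neg_neg; left.
- by apply/p_le/ax_neg_neg; right.
- by apply/p_le/ax_meet_distr; left.
- exact/p_le/ax_bot.
- exact/p_le/ax_top.
- by apply/p_le/ax_negB; right.
- by apply: (rule1 (@d_box _ [::] _ _)); eassumption.
- by apply/m_le/ax_box_meet; left.
- by apply/m_le/ax_box_meet; right.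
- by apply/m_le/ax_box_negB; right.
- by apply/m_le/ax_box_idem; right.
- exact/ax_le/ax_mpdbl4/ax_box_T.
- by apply/ax_le/ax_mpdbl4/ax_box_4; right.
- exact/ax_le/ax_box_5.
Qed.

(** Reversing the order exchanges the two halves, so every result on [modal_half] also applies to
    [Join], [Opp] and [BBox]. *)
Lemma theory_right : modal_half ge Join Opp BBox Bot Top.
Proof.
split=> *; rewrite /ge.
- exact/p_le/ax_id.
- by apply: le_trans; eassumption.
- exact/p_le/ax_joinl.
- exact/p_le/ax_joinr.
- by apply: le_trans; [apply: (rule1 (@d_joinl _ [::] _ _ _))|
    apply: (rule1 (@d_joinr _ [::] _ _ _))]; eassumption.
- exact/p_le/ax_join_idem.
- by apply: (rule1 (@d_opp _ [::] _ _)); eassumption.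
- exact/p_le/ax_opp_idem.
- exact/p_le/ax_opp_top.
- by apply/p_le/ax_opp_opp; right.
- by apply/p_le/ax_opp_opp; left.
- by apply/p_le/ax_join_distr; right.
- exact/p_le/ax_top.
- exact/p_le/ax_bot.
- by apply/p_le/ax_oppT; left.
- by apply: (rule1 (@d_bbox _ [::] _ _)); eassumption.
- by apply/m_le/ax_bbox_join; right.
- by apply/m_le/ax_bbox_join; left.
- by apply/m_le/ax_bbox_oppT; left.
- by apply/m_le/ax_bbox_idem; left.
- exact/ax_le/ax_mpdbl4/ax_bbox_T.
- by apply/ax_le/ax_mpdbl4/ax_bbox_4; left.
- exact/ax_le/ax_bbox_5.
Qed.

End Theory.

(** * The canonical model and its truth lemma *)

Section CanonicalModel.
Variable D : set sequent.
Hypothesis purity : forall s t, derivable mpdbl5_axiom [:: s; t] ->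
  derivable_modulo mpdbl5_axiom D s \/ derivable_modulo mpdbl5_axiom D t.

Let le a b := derivable_modulo mpdbl5_axiom D (Sequent a b).
Let ge a b := le b a.
Let L : modal_half le Meet Neg Box Top Bot := theory_left D.
Let R : modal_half ge Join Opp BBox Bot Top := theory_right D.

(* [set formula] lives in too high a universe to be the carrier of a context. *)
Let points := {F : formula -> Prop | ultrafilter le Meet Neg F}.
Let copoints := {J : formula -> Prop | ultrafilter ge Join Opp J}.

Definition canonical_context : context :=
  @Context points copoints (fun F J => sval F `&` sval J !=set0).

Definition canonical_kripke : kripke_context :=
  @KripkeContext canonical_context
    (fun F F' : points => forall b, sval F (Box b) <-> sval F' (Box b))
    (fun J J' : copoints => forall b, sval J (BBox b) <-> sval J' (BBox b)).

Lemma canonical_RST : KC_RST canonical_kripke.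
Proof.
split; split; try by move=> F b.
- by move=> F F' FF' b; rewrite FF'.
- by move=> F F' F'' h h' b; rewrite h.
- by move=> F F' FF' b; rewrite FF'.
- by move=> F F' F'' h h' b; rewrite h.
Qed.

Let pt (a : formula) : set (obj canonical_context) := [set F | sval F a].
Let copt (a : formula) : set (attr canonical_context) := [set J | sval J a].

(** If [J] omits [a], separation gives an ultrafilter through [a] disjoint from [J], hence not
    incident to it. Conversely [a] itself witnesses incidence. *)
Lemma up_pt a : le a (Meet a a) -> Defs.up (pt a) = copt a.
Proof.
move=> aa; apply/seteqP; split=> J; last by move=> Ja F Fa; exists a.
move=> upJ; apply: contrapT => nJa.
have [U [UU Ua UJ]] :=
  ultrafilter_avoiding_ideal L aa (ultrafilter_dual_ideal R (svalP J)) nJa.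
by have [b] := upJ (exist _ U UU) Ua; rewrite UJ.
Qed.

Lemma down_copt a : le (Join a a) a -> Defs.down (copt a) = pt a.
Proof.
move=> aa; apply/seteqP; split=> F; last by move=> Fa J Ja; exists a.
move=> downF; apply: contrapT => nFa.
have [U [UU Ua UF]] :=
  ultrafilter_avoiding_ideal R aa (ultrafilter_dual_ideal L (svalP F)) nFa.
by have [b] := downF (exist _ U UU) Ua; rewrite setIC UF.
Qed.

Lemma pt_semiconcept a : Defs.up (pt a) = copt a \/ Defs.down (copt a) = pt a.
Proof.
by have [/up_pt|/down_copt] := purity (d_pure mpdbl5_axiom a); [left|right].
Qed.

Definition canonical_semiconcept a : semiconcept canonical_context :=
  Semiconcept (pt_semiconcept a).

Lemma canonical_vobjP p : Defs.is_left (canonical_semiconcept (OVar p)).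
Proof.
by apply: up_pt; apply/derivable_modulo_axiom; do 3 constructor; exact: ax_ovar.
Qed.

Lemma canonical_vpropP p : Defs.is_right (canonical_semiconcept (PVar p)).
Proof.
by apply: down_copt; apply/derivable_modulo_axiom; do 3 constructor; exact: ax_pvar.
Qed.

Definition canonical_valuation : valuation canonical_kripke :=
  @Valuation canonical_kripke (fun p => canonical_semiconcept (OVar p))
    (fun p => canonical_semiconcept (PVar p)) canonical_vobjP canonical_vpropP.

Lemma lsemi_pt A a : A = pt a -> le a (Meet a a) ->
  ext (lsemi A) = pt a /\ int (lsemi A) = copt a.
Proof. by move=> -> aa; split=> //; exact: up_pt. Qed.

Lemma rsemi_copt B a : B = copt a -> le (Join a a) a ->
  ext (rsemi B) = pt a /\ int (rsemi B) = copt a.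
Proof. by move=> -> aa; split=> //; exact: down_copt. Qed.

(** Meet, negation and box are computed on extents and give ⊓-idempotents, whose intents [up_pt]
    supplies; their duals use [down_copt]. *)
Lemma truth a : ext (eval canonical_valuation a) = pt a /\
  int (eval canonical_valuation a) = copt a.
Proof.
elim: a => [p|p|||a [ea ia] b [eb ib]|a [ea ia] b [eb ib]|a [ea ia]|a [ea ia]|
  a [ea ia]|a [ea ia]] //=.
- split; apply/seteqP; split=> //.
    by move=> F _; exact: (uf_top L (svalP F)).
  (* [Top] is least in the reversed order, so no dual ultrafilter contains it. *)
  by move=> J /(uf_bot R (svalP J)).
- split; apply/seteqP; split=> //.
    by move=> F /(uf_bot L (svalP F)).
  by move=> J _; exact: (uf_top R (svalP J)).
- apply: lsemi_pt; last exact: (mh_meet_idem L).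
  rewrite ea eb; apply/seteqP.
  by split=> F; rewrite /pt /= (uf_meetE L (svalP F)).
- apply: rsemi_copt; last exact: (mh_meet_idem R).
  rewrite ia ib; apply/seteqP.
  by split=> J; rewrite /copt /= (uf_meetE R (svalP J)).
- apply: lsemi_pt; last exact: (mh_neg_left L).
  by rewrite ea; apply/seteqP; split=> F; rewrite /pt /= (uf_neg (svalP F)).
- apply: rsemi_copt; last exact: (mh_neg_left R).
  by rewrite ia; apply/seteqP; split=> J; rewrite /copt /= (uf_neg (svalP J)).
- apply: lsemi_pt; last exact: (mh_box_left L).
  rewrite ea; apply/seteqP; split=> F; rewrite /pt /= (uf_boxP L (svalP F)).
    by move=> Fa U UU FU; exact: (Fa (exist _ U UU)).
  by move=> Fa U FU; exact: Fa (svalP U) FU.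
- apply: rsemi_copt; last exact: (mh_box_left R).
  rewrite ia; apply/seteqP; split=> J; rewrite /copt /= (uf_boxP R (svalP J)).
    by move=> Ja U UU JU; exact: (Ja (exist _ U UU)).
  by move=> Ja U JU; exact: Ja (svalP U) JU.
Qed.

(** Of the four premises of [theory_order], two are general laws; the other two come from the
    inclusions of extents and of intents through [ultrafilter_le]. *)
Lemma canonical_sequent s : satisfies_sequent canonical_valuation s ->
  derivable_modulo mpdbl5_axiom D s.
Proof.
case: s => a b /= /sleP[]; have [-> ->] := truth a; have [-> ->] := truth b.
move=> eab iba; apply: theory_order.
- apply: (mh_trans L (mh_meet_idem L a b)).
  by apply: (mh_meet_mono L); exact: (mh_meetl L).
- by apply: (ultrafilter_le L) => U UU Ua; exact: (eab (exist _ U UU)).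
(* [ultrafilter_le] yields [Join b a], with the arguments swapped; [mh_glb] commutes them. *)
- have h : ge (Join b b) (Join b a).
    by apply: (ultrafilter_le R) => U UU Ub; exact: (iba (exist _ U UU)).
  apply: (mh_trans L _ h).
  apply: (mh_glb R (mh_meet_idem R b a)); [exact: (mh_meetr R)|exact: (mh_meetl R)].
- apply: (mh_trans R (mh_meet_idem R a b)).
  by apply: (mh_meet_mono R); exact: (mh_meetr R).
Qed.

End CanonicalModel.

Theorem theorem85 (G : hypersequent) (hG : 0 < size G) :
  valid_in KC_RST G -> MPDBL5 G.
Proof.
move=> validG; apply: contrapT => /lindenbaum[D [GD purity]].
have /List.Exists_exists[s [Gs sat]] :=
  validG _ (canonical_RST D) (canonical_valuation purity).
exact: GD Gs (canonical_sequent sat).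
Qed.
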